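(* Let $s\ge 2$ be an integer. Let $A$ and $B$ be sets with $A$ finite of order $|A|=n$, and let $f:A\rightarrow B$ be a function. Then $$\frac{1}{s-1}\left(n - \frac{N_s(f)}{s!}\right)\le V(f) \le n - N_s(f)^{1/s} + O\left(N_s(f)^{1/(s+1)}\right),$$ where the implied constant in the $O$-term depends at most on $s$ (that is, there is a constant $C_s\ge 0$, depending only on $s$, such that for all such $A,B,n,f$ one has $V(f)\le n - N_s(f)^{1/s}+C_s N_s(f)^{1/(s+1)}$).
   Context: For a function $f:A\to B$ with $A$ finite: $V(f)=|f(A)|$ is the number of distinct images of $f$. For an integer $s\ge 2$, $N_s(f)$ is the number of (ordered) $s$-tuples $(x_1,\ldots,x_s)\in A^s$ with pairwise distinct entries satisfying $f(x_1)=f(x_2)=\cdots=f(x_s)$. *)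

(* Defs.v *)
From HB Require Import structures.
From mathcomp Require Import all_boot all_order all_algebra.
From mathcomp Require Import finmap boolp reals exp.

Set Implicit Arguments.
Unset Strict Implicit.
Unset Printing Implicit Defensive.

Local Open Scope fset_scope.

(* The codomain is an arbitrary type; {classic B} is B equipped with the
   classical choiceType structure, whose boolean equality decides Leibniz
   equality. *)

Definition value_count (A : finType) (B : Type) (f : A -> B) : nat :=
  #|` [fset (f x : {classic B}) | x in A]|.

Definition coincidence_count (s : nat) (A : finType) (B : Type) (f : A -> B)
    : nat :=
  #|[set t : s.-tuple A |
      uniq t && constant [seq (f x : {classic B}) | x <- t]]|.

(* Main.v *)
Require Import Defs.
From HB Require Import structures.
From mathcomp Require Import all_boot all_order all_algebra.
From mathcomp Require Import finmap boolp reals exp.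
From mathcomp Require Import lra.

(** Let [m_y] be the size of the fibre of [f] over a value [y], so that
    [n = \sum_y m_y] and, since a coincidence tuple is an injective [s]-tuple
    inside one fibre, [N = \sum_y m_y ^_ s].  Both bounds are then inequalities
    about the positive integers [m_y], summed over the [V] values.

    Lower bound: [m <= 'C(m, s) + (s - 1)] because ['C(m, s)] grows at least
    linearly once [m >= s].  Summing gives [n <= N / s! + (s - 1) V].

    Upper bound: put [D = n - V = \sum_y (m_y - 1)].  Every fibre has at most
    [D + 1] points, hence [m_y ^_ s <= (m_y - 1) (D + 1) ^ (s - 1)]: one factor
    of the falling factorial is [m_y - 1] (this uses [s >= 2]) and each of the
    others is at most [D + 1].  Summing gives
    [N <= D (D + 1) ^ (s - 1) <= (D + 1) ^ s], that is [N ^ (1/s) <= D + 1].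
    If [N >= 1], the error term [N ^ (1/(s+1))] is at least [1], and if [N = 0]
    only [V <= n] is left; so the constant [1] works for every [s]. *)

Set Implicit Arguments.
Unset Strict Implicit.
Unset Printing Implicit Defensive.

Import Order.TTheory GRing.Theory Num.Theory.

Lemma leq_bin_addn m s : (0 < s)%N -> (m <= 'C(m, s) + s.-1)%N.
Proof.
case: s => // s _; elim: m => [|m IHm] //=.
have [le_sm|lt_ms] := leqP s m; last exact: leq_trans lt_ms (leq_addl _ _).
(* Pascal's rule: each step from [m >= s] on adds ['C(m, s) >= 1]. *)
by rewrite binS addnAC -addn1 leq_add // bin_gt0.
Qed.

Lemma ffact_leq_expn m k : (m ^_ k <= m ^ k)%N.
Proof.
elim: k m => [|k IHk] m; first by rewrite ffactn0.
rewrite ffactnS expnS leq_mul2l (leq_trans (IHk _)) ?orbT //.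
by case: k {IHk} => // k; rewrite leq_exp2r // leq_pred.
Qed.

(** The factor [m.-1] is singled out because it is the one that adds up, over
    the fibres of a map, to the defect between domain and image. *)
Lemma ffact_leq_pred_mul m d s :
  (2 <= s)%N -> (m <= d)%N -> (m ^_ s <= m.-1 * d ^ s.-1)%N.
Proof.
case: s => [|[|s]] // _ le_md; rewrite !ffactnS /= expnS mulnCA.
rewrite leq_mul // leq_mul // (leq_trans (ffact_leq_expn _ _)) //.
case: s => // s; rewrite leq_exp2r // (leq_trans (leq_pred _)) //.
exact: leq_trans (leq_pred _) le_md.
Qed.

Section Fibres.

Variables (A J : finType) (g : A -> J).

(** Coincidence tuples are grouped by the value of [g] at their head; being
    constant, [g] then confines the whole tuple to that fibre, where injective
    [s]-tuples are counted by a falling factorial.  For [s = 0] the empty tuple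
    would be counted once per element of [J]. *)
Lemma card_coincidences s : (0 < s)%N ->
  #|[set t : s.-tuple A | uniq t && constant [seq g x | x <- t]]|
    = (\sum_j #|g @^-1: [set j]| ^_ s)%N.
Proof.
case: s => // s _; rewrite -sum1_card.
rewrite (partition_big (fun t : s.+1.-tuple A => g (thead t)) predT) //=.
apply: eq_bigr => j _; rewrite -card_uniq_tuples -sum1_card.
apply: eq_bigl => t; rewrite !inE.
have /eq_all-> : mem (g @^-1: [set j]) =1 [pred y | g y == j].
  by move=> y; rewrite /= !inE.
case/tupleP: t => x t; rewrite theadE /= andbC.
have [<-|//] := eqVneq (g x) j; rewrite /= andbC all_map; congr andb.
Qed.

Lemma sum_card_fibres : (\sum_j #|g @^-1: [set j]| = #|A|)%N.
Proof.
rewrite -[RHS]sum1_card (partition_big g predT) //=.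
apply: eq_bigr => j _; rewrite -sum1_card.
by apply: eq_bigl => x; rewrite !inE.
Qed.

Lemma card_leq_sum_bin_fibres s : (0 < s)%N ->
  (#|A| <= \sum_j 'C(#|g @^-1: [set j]|, s) + s.-1 * #|J|)%N.
Proof.
move=> s_gt0; rewrite -sum_card_fibres mulnC -sum_nat_const -big_split /=.
by apply: leq_sum => j _; apply: leq_bin_addn.
Qed.

Hypothesis g_surj : forall j, exists x, g x = j.

Lemma card_fibre_gt0 j : (0 < #|g @^-1: [set j]|)%N.
Proof. by have [x <-] := g_surj j; apply/card_gt0P; exists x; rewrite !inE. Qed.

(** The difference [#|A| - #|J|] is distributed over the fibres: each of them,
    being nonempty, loses one point to the image. *)
Lemma sum_pred_card_fibres :
  (\sum_j #|g @^-1: [set j]|.-1 + #|J| = #|A|)%N.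
Proof.
rewrite -sum_card_fibres -sum1_card -big_split /=.
by apply: eq_bigr => j _; rewrite addn1 prednK // card_fibre_gt0.
Qed.

(** A single fibre exceeds [1] by at most the total defect [#|A| - #|J|]; that
    bounds all factors of each falling factorial but one, and the remaining
    ones sum to the defect. *)
Lemma sum_ffact_fibres_leq s : (2 <= s)%N ->
  (\sum_j #|g @^-1: [set j]| ^_ s <= (#|A| - #|J|).+1 ^ s)%N.
Proof.
move=> s_ge2; rewrite -sum_pred_card_fibres addnK.
set D := (\sum_j _.-1)%N.
have fibre_le j : (#|g @^-1: [set j]| <= D.+1)%N.
  by rewrite -[leqLHS]prednK ?card_fibre_gt0 // ltnS /D (bigD1 j) //= leq_addr.
apply: (@leq_trans (D * D.+1 ^ s.-1)).
  rewrite /D big_distrl /=.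
  by apply: leq_sum => j _; apply: ffact_leq_pred_mul.
by rewrite -{2}(ltn_predK s_ge2) expnS leq_mul2r leqnSn orbT.
Qed.

End Fibres.

(** Sums over the fibres need a finite index type, which the arbitrary codomain
    [B] does not provide: [J] is the image of [f] and [g] its corestriction,
    under which the same points collide. *)
Lemma image_factorization (A : finType) (B : Type) (f : A -> B) :
  exists (J : finType) (g : A -> J),
    [/\ forall j, exists x, g x = j, value_count f = #|J| &
        forall s, coincidence_count s f =
          #|[set t : s.-tuple A | uniq t && constant [seq g x | x <- t]]|].
Proof.
pose I := [fset (f x : {classic B}) | x in A]%fset.
have fI x : (f x : {classic B}) \in I by apply/imfsetP; exists x.
exists I, (fun x => [` fI x]%fset); split=> [j||s].
- have /imfsetP[x _ jE] := valP j.
  by exists x; apply/val_inj; rewrite /= -jE.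
- by rewrite -cardfE.
- rewrite /coincidence_count; apply: eq_card => t; rewrite !inE.
  congr andb; case: (tval t) => //= x r.
  by rewrite !all_map; apply: eq_all.
Qed.

Local Open Scope ring_scope.

Theorem theorem1 (R : realType) (s : nat) (hs : (2 <= s)%N) :
  exists C : R, 0 <= C /\
    forall (A : finType) (B : Type) (f : A -> B) (n : nat), #|A| = n ->
      (s%:R - 1)^-1 * (n%:R - (coincidence_count s f)%:R / (s`!)%:R)
        <= (value_count f)%:R :> R /\
      (value_count f)%:R
        <= n%:R - (coincidence_count s f)%:R `^ (s%:R)^-1
           + C * (coincidence_count s f)%:R `^ (s.+1%:R)^-1.
Proof.
have s_gt0 : (0 < s)%N by apply: ltnW.
exists 1; split=> // A B f n <-{n}.
have [J [g [g_surj -> ->]]] := image_factorization f.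
rewrite card_coincidences //; split.
  have sE : s%:R - 1 = s.-1%:R :> R by rewrite -[in LHS](prednK s_gt0) -natr1 addrK.
  have s1_gt0 : (0 < s.-1)%N by rewrite -ltnS prednK.
  rewrite sE mulrC ler_pdivrMr ?ltr0n //.
  under eq_bigr => j _ do rewrite -bin_ffact.
  rewrite -big_distrl /= natrM mulfK ?pnatr_eq0 -?lt0n ?fact_gt0 //.
  rewrite lerBlDl -natrM -natrD ler_nat [(#|J| * _)%N]mulnC.
  exact: card_leq_sum_bin_fibres.
have leJA : (#|J| <= #|A|)%N by rewrite -(sum_pred_card_fibres g_surj) leq_addl.
have := sum_ffact_fibres_leq g_surj hs.
set N := (\sum_j _)%N; move=> leN; rewrite mul1r.
have [->|N_gt0] := posnP N.
  by rewrite !powR0 ?invr_eq0 ?pnatr_eq0 -?lt0n // subr0 addr0 ler_nat.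
have root_le : N%:R `^ s%:R^-1 <= (#|A| - #|J|).+1%:R :> R.
  have -> : (#|A| - #|J|).+1%:R = ((#|A| - #|J|).+1 ^ s)%N%:R `^ s%:R^-1 :> R.
    by rewrite natrX -powR_mulrn // -powRrM mulfV ?powRr1 ?pnatr_eq0 -?lt0n.
  by rewrite ge0_ler_powR ?nnegrE ?invr_ge0 ?ler0n ?ler_nat.
have error_ge1 : 1 <= N%:R `^ s.+1%:R^-1 :> R.
  have /le_trans-> // : (1 : R) <= 1 `^ s.+1%:R^-1 by rewrite powR1.
  by rewrite ge0_ler_powR ?nnegrE ?invr_ge0 ?ler0n ?ler1n.
rewrite -natr1 natrB // in root_le.
lra.
Qed.
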